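(* Let $\mathcal{H}$ be a complex Hilbert space, let $A\in\mathbb{B}(\mathcal{H})$ be a positive operator, and let $T,S\in\mathbb{B}_{A^{1/2}}(\mathcal{H})$. Then $$\Big(\inf_{\gamma\in\mathbb{C}}\|T+\gamma S\|_A\Big)^2=\sup_{x\in\mathcal{H},\ \|x\|_A=1}\Phi^{(T,S)}_A(x),$$ where $$\Phi^{(T,S)}_A(x)=\begin{cases}\|Tx\|_A^2-\dfrac{|\langle Tx,Sx\rangle_A|^2}{\|Sx\|_A^2} & \text{if } \|Sx\|_A\neq 0,\\[2mm] \|Tx\|_A^2 & \text{if } \|Sx\|_A=0.\end{cases}$$
   Context: $\mathbb{B}(\mathcal{H})$ denotes the bounded linear operators on the complex Hilbert space $(\mathcal{H},\langle\cdot,\cdot\rangle)$. An operator $A\in\mathbb{B}(\mathcal{H})$ is positive if $\langle Ax,x\rangle\ge 0$ for all $x\in\mathcal{H}$. Put $\langle x,y\rangle_A=\langle Ax,y\rangle$ and $\|x\|_A=\sqrt{\langle x,x\rangle_A}$ (a seminorm). $\mathbb{B}_{A^{1/2}}(\mathcal{H})$ is the set of $T\in\mathbb{B}(\mathcal{H})$ for which there is $c>0$ with $\|Tx\|_A\le c\|x\|_A$ for all $x\in\mathcal{H}$. For such $T$, $\|T\|_A=\inf\{c>0:\ \|Tx\|_A\le c\|x\|_A \text{ for all } x\in\mathcal{H}\}$. The supremum of an empty set of nonnegative reals (which occurs only if $A=0$) is taken to be $0$. *)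

(* Defs.v *)
From HB Require Import structures.
From mathcomp Require Import all_boot all_order all_algebra.
From mathcomp Require Import sesquilinear complex.
From mathcomp Require Import all_classical all_reals all_analysis.

Set Implicit Arguments.
Unset Strict Implicit.
Unset Printing Implicit Defensive.

Import Order.TTheory GRing.Theory Num.Theory.
Import numFieldNormedType.Exports.

Local Open Scope classical_set_scope.
Local Open Scope ring_scope.
Local Open Scope complex_scope.

(* A complex Hilbert space is a complete normed R[i]-module [H] together with
   an inner product [ip] satisfying [inner_product_norm ip].  As in
   {dot H for conjC}, [ip] is linear in its first argument and
   conjugate-linear in the second. *)
Definition inner_product_norm (R : realType) (H : completeNormedModType R[i])
    (ip : {dot H for Num.conj}) : Prop :=
  forall x : H, `|x| ^+ 2 = ip x x.

Definition bounded_operator (R : realType) (H : completeNormedModType R[i])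
    (T : H -> H) : Prop :=
  exists c : R, forall x : H, `|T x| <= c%:C * `|x|.

(* In R[i], [0 <= z] means that z is real and nonnegative. *)
Definition positive_operator (R : realType) (H : completeNormedModType R[i])
    (ip : {dot H for Num.conj}) (A : H -> H) : Prop :=
  forall x : H, 0 <= ip (A x) x.

Section ASeminorm.
Variables (R : realType) (H : completeNormedModType R[i]).
Variables (ip : {dot H for Num.conj}) (A : H -> H).

Definition ipA (x y : H) : R[i] := ip (A x) y.

(* For positive [A], [ipA x x] is real and nonnegative, so that taking the real
   part only changes the type. *)
Definition normA (x : H) : R := Num.sqrt (complex.Re (ipA x x)).

Definition A_bounded (T : H -> H) : Prop :=
  exists2 c : R, 0 < c & forall x : H, normA (T x) <= c * normA x.

Definition opnormA (T : H -> H) : R :=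
  inf [set c : R | 0 < c /\ forall x : H, normA (T x) <= c * normA x].

Definition PhiA (T S : H -> H) (x : H) : R :=
  if normA (S x) != 0 then
    normA (T x) ^+ 2
      - ComplexField.Normc.normc (ipA (T x) (S x)) ^+ 2 / normA (S x) ^+ 2
  else normA (T x) ^+ 2.

End ASeminorm.

(* Main.v *)
(* For fixed x, Phi x is the minimum over g of the quadratic |(T + g S) x|_A^2,
   so the theorem exchanges an infimum over g and a supremum over x.  The
   quadratics are affine not in x but in the state x x^*; convexity
   of the numerical range, in the one-sided form of [numerical_range_segment],
   shows that a mixture of states is dominated by a unit vector with the same
   value of <(T + g S) x, S x>_A, so passing to mixtures does not increase
   sup Phi.  The minimax inequality then follows from a near-maximiser argument
   on the mixtures containing a small fixed proportion of a state y0 with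
   |S y0|_A <> 0: this bounds the leading coefficients away from 0, and the
   proportion is sent to 0 in the end. *)
Require Import Defs.
From HB Require Import structures.
From mathcomp Require Import all_boot all_order all_algebra.
From mathcomp Require Import sesquilinear complex ring lra.
From mathcomp Require Import all_classical all_reals all_analysis.

Set Implicit Arguments.
Unset Strict Implicit.
Unset Printing Implicit Defensive.

Import Order.TTheory GRing.Theory Num.Theory.
Import numFieldNormedType.Exports.

Local Open Scope classical_set_scope.
Local Open Scope ring_scope.
Local Open Scope complex_scope.

(** * Kernel vectors and singular 2 by 2 Hermitian matrices *)

Lemma wide_kernel (F : fieldType) (m n : nat) (M : 'M[F]_(m, n)) :
  (n < m)%N -> exists2 v : 'rV_m, v != 0 & v *m M = 0.
Proof.
move=> nm; have : kermx M != 0.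
  rewrite kermx_eq0; apply: contraL nm => /eqP rM.
  by rewrite -leqNgt -rM rank_leq_col.
by move=> /rowV0Pn[v /sub_kermxP vM v0]; exists v.
Qed.

(** With d = |ze|^2, this follows the ray from diag(p, q) in the direction [[a, ze], [ze^*, b]]. The
    direction has negative determinant, so the ray leaves the positive semidefinite cone, and it
    does so at a singular matrix. *)
Lemma singular_psd_on_ray (R : rcfType) (p q a b d : R) :
  0 <= p -> 0 <= q -> 0 <= d -> a * b < d ->
  exists2 t, 0 <= t &
    [/\ 0 <= p + t * a, 0 <= q + t * b & (p + t * a) * (q + t * b) = t ^+ 2 * d].
Proof.
move=> p0 q0 d0 abd.
pose e := p * b + q * a; pose k := d - a * b.
have k0 : 0 < k by rewrite /k subr_gt0.
have pq0 : 0 <= p * q by apply: mulr_ge0.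
have D0 : 0 <= e ^+ 2 + 4 * k * (p * q).
  by rewrite addr_ge0 ?sqr_ge0// mulr_ge0// mulr_ge0// ltW.
pose s := Num.sqrt (e ^+ 2 + 4 * k * (p * q)).
have s2 : s ^+ 2 = e ^+ 2 + 4 * k * (p * q) by rewrite sqr_sqrtr.
have es : - e <= s.
  rewrite (le_trans (ler_norm _))// normrN -sqrtr_sqr ler_wsqrtr//.
  by rewrite lerDl mulr_ge0// mulr_ge0// ltW.
(* The nonnegative root of k t^2 - e t - p q, which is minus the determinant along the ray. *)
pose t := (e + s) / (2 * k).
have t0 : 0 <= t by rewrite divr_ge0 ?mulr_ge0 ?(ltW k0)//; lra.
have tk : t * (2 * k) = e + s by rewrite divfK// mulf_neq0// gt_eqF.
have gt : (p + t * a) * (q + t * b) = t ^+ 2 * d.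
  apply/eqP; rewrite -subr_eq0; apply/eqP.
  apply: (@mulfI _ (4 * k)); first by rewrite mulf_neq0// gt_eqF.
  rewrite mulr0; transitivity (e ^+ 2 + 4 * k * (p * q) - (t * (2 * k) - e) ^+ 2).
    by rewrite /e /k; ring.
  by rewrite tk -s2; ring.
have g0 : 0 <= (p + t * a) * (q + t * b) by rewrite gt mulr_ge0 ?sqr_ge0.
(* If u + t x were negative, the other factor would be at most 0, and dropping u, v >= 0 would give
   t^2 d <= t^2 x y, against x y < d. *)
have key u v x y : 0 <= u -> 0 <= v -> x * y < d ->
    (u + t * x) * (v + t * y) = t ^+ 2 * d -> 0 <= u + t * x.
  move=> u0 v0 xyd E; rewrite leNgt; apply/negP => neg.
  have g1 : 0 <= (u + t * x) * (v + t * y) by rewrite E mulr_ge0 ?sqr_ge0.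
  have vy : v + t * y <= 0 by rewrite -(nmulr_rge0 _ neg).
  have tx : t * x < 0 by lra.
  have t1 : 0 < t.
    by rewrite lt_neqAle t0 andbT; apply: contraTneq tx => <-; rewrite mul0r ltxx.
  have : t ^+ 2 * d <= (t * x) * (t * y).
    rewrite -E -[leRHS]mulrNN -[leLHS]mulrNN ler_pM//; lra.
  rewrite (_ : _ * _ * (t * y) = t ^+ 2 * (x * y)); last by ring.
  by rewrite ler_pM2l ?exprn_gt0// leNgt xyd.
exists t => //; split => //; first exact: (key p q a b).
by apply: (key q p b a) => //; [rewrite mulrC | rewrite mulrC].
Qed.

(** * Sesquilinear forms and rank-one states *)

Definition sesquilinear_form (R : rcfType) (V : lmodType R[i])
    (f : V -> V -> R[i]) : Prop :=
  (forall k x x' y, f (k *: x + x') y = k * f x y + f x' y) /\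
  (forall k x y y', f x (k *: y + y') = k^*%C * f x y + f x y').

Section Sesquilinear.
Variables (R : rcfType) (V : lmodType R[i]) (f : V -> V -> R[i]).
Hypothesis sf : sesquilinear_form f.

Lemma sesqDl x x' y : f (x + x') y = f x y + f x' y.
Proof. by have := sf.1 1 x x' y; rewrite scale1r mul1r. Qed.
Lemma sesqDr x y y' : f x (y + y') = f x y + f x y'.
Proof. by have := sf.2 1 x y y'; rewrite scale1r conjc1 mul1r. Qed.
Lemma sesq0l y : f 0 y = 0.
Proof. by apply: (addrI (f 0 y)); rewrite -sesqDl !addr0. Qed.
Lemma sesq0r x : f x 0 = 0.
Proof. by apply: (addrI (f x 0)); rewrite -sesqDr !addr0. Qed.
Lemma sesqZl k x y : f (k *: x) y = k * f x y.
Proof. by rewrite -[k *: x]addr0 sf.1 sesq0l addr0. Qed.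
Lemma sesqZr k x y : f x (k *: y) = k^*%C * f x y.
Proof. by rewrite -[k *: y]addr0 sf.2 sesq0r addr0. Qed.

Lemma sesq_comb a c x y : f (a *: x + c *: y) (a *: x + c *: y) =
  a * a^*%C * f x x + c * c^*%C * f y y + a * c^*%C * f x y + c * a^*%C * f y x.
Proof. by rewrite !(sesqDl, sesqDr, sesqZl, sesqZr); ring. Qed.

Lemma sesq_lin (T S : {linear V -> V}) : sesquilinear_form (fun x y => f (T x) (S y)).
Proof. by split=> k *; rewrite linearP ?sf.1 ?sf.2. Qed.


End Sesquilinear.

(* The Hermitian matrix [[al, ze], [ze^*, be]], of rank at most one, is the state z z^*. *)
Lemma rank_one_vector (R : rcfType) (V : lmodType R[i]) (x y : V)
    (al be : R) (ze : R[i]) :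
  0 <= al -> 0 <= be -> (al * be)%:C = ze * ze^*%C ->
  exists z, forall f, sesquilinear_form f ->
    f z z = al%:C * f x x + be%:C * f y y + ze * f x y + ze^*%C * f y x.
Proof.
move=> al0 be0 E; have [al1|] := ltP 0 al.
  pose r := Num.sqrt al.
  have rr : r * r = al by rewrite -expr2 sqr_sqrtr.
  have r0 : r != 0 by rewrite gt_eqF// sqrtr_gt0.
  have rV : r%:C * (r^-1)%:C = 1 by rewrite -rmorphM divff.
  (* The coefficients have cross product ze and first squared modulus al; the determinant condition
     [E] then makes the second squared modulus be. *)
  exists (r%:C *: x + ((r^-1)%:C * ze^*%C) *: y) => f sf.
  have rVJ : ((r^-1)%:C * ze^*%C)^*%C = (r^-1)%:C * ze.
    by rewrite rmorphM /= conjcK [X in X * _]conjc_real.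
  rewrite (sesq_comb sf) rVJ [(r%:C)^*%C]conjc_real -rmorphM rr.
  have -> : (r^-1)%:C * ze^*%C * ((r^-1)%:C * ze) = be%:C.
    transitivity (((r^-1)%:C * (r^-1)%:C) * (ze * ze^*%C)); first by ring.
    by rewrite -E -!rmorphM -rr; congr _%:C; field.
  have -> : r%:C * ((r^-1)%:C * ze) = ze by rewrite mulrA rV mul1r.
  by have -> : (r^-1)%:C * ze^*%C * r%:C = ze^*%C by rewrite mulrC mulrA rV mul1r.
move=> al1; have al2 : al = 0 by apply/le_anti; rewrite al0 al1.
have ze0 : ze = 0.
  have : ze * ze^*%C == 0 by rewrite -E al2 mul0r.
  by rewrite mulf_eq0 conjc_eq0 orbb => /eqP.
exists ((Num.sqrt be)%:C *: y) => f sf.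
rewrite (sesqZl sf) (sesqZr sf) [X in _ * (X * _)]conjc_real mulrA -rmorphM -expr2 sqr_sqrtr//.
by rewrite al2 ze0 conjc0 !mul0r !addr0 add0r.
Qed.

(** * Positive semidefinite forms, possibly degenerate *)

Section PositiveForm.
Variables (R : rcfType) (V : lmodType R[i]) (phi : V -> V -> R[i]).
Hypothesis sphi : sesquilinear_form phi.
Hypothesis phi_ge0 : forall x, 0 <= phi x x.

Let N x := complex.Re (phi x x).

(** Polarization: the values at x, y, x + y and x + i y are all real. *)
Lemma positive_hermitian x y : phi y x = (phi x y)^*%C.
Proof.
have := ger0_Im (phi_ge0 (1 *: x + 1 *: y)).
have := ger0_Im (phi_ge0 (1 *: x + 'i%C *: y)).
have := ger0_Im (phi_ge0 x); have := ger0_Im (phi_ge0 y).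
rewrite !(sesq_comb sphi).
case: (phi x x) (phi y y) (phi x y) (phi y x) => [a b] [c d] [e f] [g h] /= -> -> H1 H2.
by congr Complex; lra.
Qed.

Lemma semi_norm2_ge0 x : 0 <= N x.
Proof. by have := phi_ge0 x; rewrite lecE => /andP[_]. Qed.

Lemma positive_diag x : phi x x = (N x)%:C.
Proof.
by have := ger0_Im (phi_ge0 x); rewrite /N; case: (phi x x) => a b /= ->.
Qed.

Lemma semi_norm2_comb a b c d x y :
  N ((Complex a b) *: x + (Complex c d) *: y) =
  (a ^+ 2 + b ^+ 2) * N x + (c ^+ 2 + d ^+ 2) * N y +
  2 * ((a * c + b * d) * complex.Re (phi x y) + (a * d - b * c) * complex.Im (phi x y)).
Proof.
rewrite /N (sesq_comb sphi) (positive_hermitian x y).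
have := ger0_Im (phi_ge0 x); have := ger0_Im (phi_ge0 y).
case: (phi x x) (phi y y) (phi x y) => [e f] [g h] [k l] /= -> ->.
by ring.
Qed.

Lemma positive_CauchySchwarz x y :
  complex.Re (phi x y) ^+ 2 + complex.Im (phi x y) ^+ 2 <= N x * N y.
Proof.
set u := complex.Re _; set v := complex.Im _.
have E a c d : 0 <= a ^+ 2 * N x + (c ^+ 2 + d ^+ 2) * N y + 2 * (a * c * u + a * d * v).
  have := semi_norm2_ge0 (Complex a 0 *: x + Complex c d *: y).
  by rewrite semi_norm2_comb -/u -/v expr0n /= addr0 !mul0r addr0 subr0.
have [y0|y0] := eqVneq (N y) 0; last first.
  have yp : 0 < N y by rewrite lt_neqAle eq_sym y0 semi_norm2_ge0.
  rewrite -subr_ge0 -(pmulr_rge0 _ yp).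
  (* Nonnegativity at the vector N(y) x - phi(x, y) y. *)
  apply: (le_trans (E (N y) (- u) (- v))).
  by rewrite le_eqVlt; apply/orP; left; apply/eqP; ring.
rewrite y0 mulr0 leNgt; apply/negP => w0; set w := u ^+ 2 + v ^+ 2 in w0.
(* For N y = 0 the form at x - t phi(x, y) y is affine in t with slope -2 w; this t gives it the
   value -1. *)
pose t := (N x + 1) / (2 * w).
have tw : t * (2 * w) = N x + 1 by rewrite divfK// mulf_neq0// gt_eqF.
have := E 1 (- t * u) (- t * v); rewrite y0.
rewrite (_ : _ + _ = N x - t * (2 * w)); last by rewrite /w; ring.
by rewrite tw; lra.
Qed.

Lemma null_orthogonal x y : N x = 0 -> phi x y = 0.
Proof.
move=> x0; have := positive_CauchySchwarz x y; rewrite x0 mul0r => h.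
have /eqP : complex.Re (phi x y) ^+ 2 + complex.Im (phi x y) ^+ 2 = 0.
  by apply/le_anti; rewrite h addr_ge0 ?sqr_ge0.
rewrite paddr_eq0 ?sqr_ge0// !sqrf_eq0 => /andP[/eqP a /eqP b].
by case: (phi x y) a b => ? ? /= -> ->.
Qed.

(** * One-sided convexity of the joint numerical range *)

Section NumericalRange.
Variables T S : {linear V -> V}.
Hypothesis Tnull : forall x, N x = 0 -> N (T x) = 0.
Hypothesis Snull : forall x, N x = 0 -> N (S x) = 0.

(** Equality in Cauchy-Schwarz makes y - c x a null vector for the unimodular c = phi(x, y)^*. T and
    S send it to null vectors, which are orthogonal to everything, and the phase c cancels. *)
Lemma parallel_same_values x y : N x = 1 -> N y = 1 ->
  complex.Re (phi x y) ^+ 2 + complex.Im (phi x y) ^+ 2 = 1 ->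
  phi (T y) (S y) = phi (T x) (S x) /\ N (T y) = N (T x).
Proof.
move=> x1 y1 n1; pose c := (phi x y)^*%C; pose d := y - c *: x.
have cc : c * c^*%C = 1.
  rewrite /c; case: (phi x y) n1 => a b /= n1; apply/eqP; rewrite eq_complex /=.
  by apply/andP; split; apply/eqP; rewrite -?n1; ring.
have d0 : N d = 0.
  rewrite /d /c; case E : (phi x y) => [a b] /=.
  have -> : y - Complex a (- b) *: x = Complex (- a) b *: x + Complex 1 0 *: y.
    rewrite (_ : Complex (- a) b = - Complex a (- b)).
      by rewrite scaleNr addrC; congr (_ + _); exact/esym/scale1r.
    by apply/eqP; rewrite eq_complex /= opprK !eqxx.
  by rewrite semi_norm2_comb x1 y1; move: n1; rewrite E /= => n1; lra.
have -> : y = c *: x + 1 *: d by rewrite scale1r addrC subrK.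
have Td := Tnull d0; have Sd := Snull d0.
have key (U : {linear V -> V}) : N (U d) = 0 ->
    phi (T (c *: x + 1 *: d)) (U (c *: x + 1 *: d)) = phi (T x) (U x).
  move=> Ud; have /= -> := sesq_comb (sesq_lin sphi T U) c 1 x d.
  rewrite cc !(null_orthogonal _ Td) (positive_hermitian (U d)) (null_orthogonal _ Ud).
  by rewrite conjc0 !mulr0 !addr0 mul1r.
by split; [exact: (key S Sd) | rewrite /N (key T Td)].
Qed.

(** A Hermitian 2 by 2 matrix has four real parameters, and keeping N and the complex value phi(T.,
    S.) fixed imposes three real linear equations. A nonzero solution exists, and its sign is free,
    so N(T.) can be made not to decrease. *)
Lemma hermitian_kernel_direction x y : exists al be z1 z2 : R,
  [/\ [|| al != 0, be != 0, z1 != 0 | z2 != 0],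
     al * N x + be * N y + 2 * (z1 * complex.Re (phi x y) - z2 * complex.Im (phi x y)) = 0,
     al%:C * phi (T x) (S x) + be%:C * phi (T y) (S y) +
       Complex z1 z2 * phi (T x) (S y) + Complex z1 (- z2) * phi (T y) (S x) = 0 &
     0 <= al * N (T x) + be * N (T y) +
       2 * (z1 * complex.Re (phi (T x) (T y)) - z2 * complex.Im (phi (T x) (T y)))].
Proof.
case F1 : (phi (T x) (S x)) => [f1 g1]; case F2 : (phi (T y) (S y)) => [f2 g2].
case F3 : (phi (T x) (S y)) => [f3 g3]; case F4 : (phi (T y) (S x)) => [f4 g4].
(* Rows: the unknowns al, be, z1, z2. Columns: N, then the real and imaginary parts of phi(T.,
   S.). *)
pose M : 'M[R]_(4, 3) := \matrix_(i, j) nth 0 (nth [::] [::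
  [:: N x; f1; g1]; [:: N y; f2; g2];
  [:: 2 * complex.Re (phi x y); f3 + f4; g3 + g4];
  [:: - 2 * complex.Im (phi x y); g4 - g3; f3 - f4]] i) j.
have [v v0 vM] := wide_kernel M isT.
pose o k (h : (k < 4)%N) : 'I_4 := Ordinal h.
pose a := v 0 (@o 0%N isT); pose b := v 0 (@o 1%N isT).
pose c := v 0 (@o 2%N isT); pose d := v 0 (@o 3%N isT).
have E j : a * M (@o 0%N isT) j + b * M (@o 1%N isT) j + c * M (@o 2%N isT) j
    + d * M (@o 3%N isT) j = 0.
  move/matrixP : vM => /(_ 0 j); rewrite mxE [RHS]mxE => <-.
  by rewrite !big_ord_recl big_ord0 addr0 !addrA; congr (_ + _ + _ + _);
    congr (v _ _ * M _ _); apply/val_inj.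
have nz : [|| a != 0, b != 0, c != 0 | d != 0].
  apply: contraNT v0; rewrite !negb_or !negbK => /and4P[a0 b0 c0 d0].
  have o_eq (k : nat) (h h' : (k < 4)%N) : Ordinal h = o k h'.
    by congr Ordinal; exact: bool_irrelevance.
  apply/eqP/rowP => -[[|[|[|[|//]]]] h]; rewrite mxE (o_eq _ h isT); apply/eqP;
    [exact: a0 | exact: b0 | exact: c0 | exact: d0].
have := E (Ordinal (isT : (0 < 3)%N)); have := E (Ordinal (isT : (1 < 3)%N)).
have := E (Ordinal (isT : (2 < 3)%N)); rewrite !mxE /= => E3 E2 E1.
set h := fun al be z1 z2 => al * N (T x) + be * N (T y) +
  2 * (z1 * complex.Re (phi (T x) (T y)) - z2 * complex.Im (phi (T x) (T y))).
have sgn (e u w : R) : u = 0 -> w = e * u -> w = 0 by move=> -> ->; rewrite mulr0.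
have [h0|h0] := leP 0 (h a b c d).
  exists a, b, c, d; split => //; first by apply: (sgn 1 _ _ E1); ring.
  apply/eqP; rewrite eq_complex /=; apply/andP; split; apply/eqP.
    by apply: (sgn 1 _ _ E2); ring.
  by apply: (sgn 1 _ _ E3); ring.
exists (- a), (- b), (- c), (- d); split.
- by rewrite !oppr_eq0.
- by apply: (sgn (- 1) _ _ E1); ring.
- apply/eqP; rewrite eq_complex /=; apply/andP; split; apply/eqP.
    by apply: (sgn (- 1) _ _ E2); ring.
  by apply: (sgn (- 1) _ _ E3); ring.
- by move: h0; rewrite /h => h0; lra.
Qed.

(** Start at the mixed state p x x^* + q y y^* and move along the kernel direction until the state
    becomes singular, hence of rank one. On the way N and phi(T., S.) stay constant and N(T.) does
    not decrease. *)
Lemma numerical_range_segment x y p q : 0 <= p -> 0 <= q -> p + q = 1 ->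
  N x = 1 -> N y = 1 -> exists z, [/\ N z = 1,
    phi (T z) (S z) = p%:C * phi (T x) (S x) + q%:C * phi (T y) (S y) &
    p * N (T x) + q * N (T y) <= N (T z)].
Proof.
move=> p0 q0 pq x1 y1.
have CS := positive_CauchySchwarz x y; rewrite x1 y1 mulr1 in CS.
have [n1|n1] := eqVneq (complex.Re (phi x y) ^+ 2 + complex.Im (phi x y) ^+ 2) 1.
  have [-> ->] := parallel_same_values x1 y1 n1.
  by exists x; rewrite -!mulrDl -rmorphD pq !mul1r.
have {CS n1} n1 : complex.Re (phi x y) ^+ 2 + complex.Im (phi x y) ^+ 2 < 1.
  by rewrite lt_neqAle n1.
have [al [be [z1 [z2 [nz]]]]] := hermitian_kernel_direction x y.
rewrite x1 y1 !mulr1; set r := complex.Re _; set s := complex.Im _ => E1 E2 E3.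
rewrite -/r -/s in n1.
(* The direction is indefinite: by [E1], al be <= (al + be)^2 / 4 = Re(ze phi(x, y))^2, which is
   below |ze|^2 since |phi(x, y)| < 1. If ze = 0, then be = - al is nonzero. *)
have det : al * be < z1 ^+ 2 + z2 ^+ 2.
  have ab : (al + be) ^+ 2 = 4 * (z1 * r - z2 * s) ^+ 2.
    by rewrite (_ : al + be = - (2 * (z1 * r - z2 * s))); [ring | lra].
  have le4 : 4 * (al * be) <= (al + be) ^+ 2.
    by rewrite -subr_ge0 (_ : _ - _ = (al - be) ^+ 2) ?sqr_ge0//; ring.
  have [z0|z0] := eqVneq (z1 ^+ 2 + z2 ^+ 2) 0.
    move: z0 => /eqP; rewrite paddr_eq0 ?sqr_ge0// !sqrf_eq0 => /andP[/eqP z10 /eqP z20].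
    move: nz E1; rewrite z10 z20 eqxx /= orbF !mul0r subr0 mulr0 addr0 => nz E1.
    have ba : be = - al by lra.
    move: nz; rewrite ba oppr_eq0 orbb => al0.
    by rewrite expr0n addr0 mulrN oppr_lt0 -expr2 exprn_even_gt0.
  have zp : 0 < z1 ^+ 2 + z2 ^+ 2 by rewrite lt_neqAle eq_sym z0 addr_ge0 ?sqr_ge0.
  have cs : (z1 * r - z2 * s) ^+ 2 <= (z1 ^+ 2 + z2 ^+ 2) * (r ^+ 2 + s ^+ 2).
    by rewrite -subr_ge0 (_ : _ - _ = (z1 * s + z2 * r) ^+ 2) ?sqr_ge0//; ring.
  have : (z1 ^+ 2 + z2 ^+ 2) * (r ^+ 2 + s ^+ 2) < z1 ^+ 2 + z2 ^+ 2.
    by rewrite -[ltRHS]mulr1 ltr_pM2l.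
  lra.
have [t t0 [A B AB]] := singular_psd_on_ray p0 q0 (addr_ge0 (sqr_ge0 z1) (sqr_ge0 z2)) det.
have zz : ((p + t * al) * (q + t * be))%:C =
    Complex (t * z1) (t * z2) * (Complex (t * z1) (t * z2))^*%C.
  by rewrite AB; apply/eqP; rewrite eq_complex /=; apply/andP; split; apply/eqP; ring.
have [z Ez] := rank_one_vector x y A B zz.
have Nz U : phi (U z) (U z) =
      (p + t * al)%:C * phi (U x) (U x) + (q + t * be)%:C * phi (U y) (U y) +
      Complex (t * z1) (t * z2) * phi (U x) (U y) +
      (Complex (t * z1) (t * z2))^*%C * phi (U y) (U x) ->
    N (U z) = p * N (U x) + q * N (U y) + t * (al * N (U x) + be * N (U y) +
      2 * (z1 * complex.Re (phi (U x) (U y)) - z2 * complex.Im (phi (U x) (U y)))).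
  rewrite {1}/N => ->; rewrite !positive_diag (positive_hermitian (U x)).
  by case: (phi (U x) (U y)) => a b /=; ring.
exists z; split.
- rewrite (Nz id) ?x1 ?y1 ?mulr1 ?E1 ?mulr0 ?addr0 //; exact: Ez.
- have /= -> := Ez _ (sesq_lin sphi T S).
  transitivity (p%:C * phi (T x) (S x) + q%:C * phi (T y) (S y) + t%:C *
    (al%:C * phi (T x) (S x) + be%:C * phi (T y) (S y) +
       Complex z1 z2 * phi (T x) (S y) + Complex z1 (- z2) * phi (T y) (S x))).
    rewrite !rmorphD !rmorphM.
    have -> : Complex (t * z1) (t * z2) = t%:C * Complex z1 z2.
      by apply/eqP; rewrite eq_complex /=; apply/andP; split; apply/eqP; ring.
    have -> : Complex (t * z1) (- (t * z2)) = t%:C * Complex z1 (- z2).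
      by apply/eqP; rewrite eq_complex /=; apply/andP; split; apply/eqP; ring.
    by ring.
  by rewrite E2 mulr0 addr0.
- rewrite (Nz T (Ez _ (sesq_lin sphi T T))) lerDl mulr_ge0//.
Qed.

End NumericalRange.
End PositiveForm.

(** * An approximate minimax inequality for quadratics in the plane *)

(* The quadratic in g + i h below is minimal at - (u + i v) / b, with value
   a - (u^2 + v^2) / b.  The minimiser at a point of K where this value is
   nearly maximal is nearly a saddle point: moving a fraction t towards any
   other point of K gains to first order in t. *)
Lemma quadratic_minimax (R : realType) (K : R -> R -> R -> R -> Prop) (P W B bt e : R) :
  (forall t a u v b a' u' v' b' : R, 0 <= t -> t <= 1 -> K a u v b -> K a' u' v' b' ->
     K ((1 - t) * a + t * a') ((1 - t) * u + t * u')
       ((1 - t) * v + t * v') ((1 - t) * b + t * b')) ->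
  (exists a u v b, K a u v b) ->
  0 < bt -> 0 < e ->
  (forall a u v b, K a u v b ->
     [/\ `|u| <= W, `|v| <= W, bt <= b, b <= B & a - (u ^+ 2 + v ^+ 2) / b <= P]) ->
  exists g h, forall a u v b, K a u v b ->
    a + 2 * (g * u + h * v) + (g ^+ 2 + h ^+ 2) * b <= P + e.
Proof.
move=> Kconv [a1 [u1 [v1 [b1 K1]]]] bt0 e0 Kb.
pose E := [set r | exists a u v b, K a u v b /\ r = a - (u ^+ 2 + v ^+ 2) / b].
have EP : ubound E P by move=> r [a [u [v [b [/Kb[_ _ _ _ le_P] ->]]]]].
have supE : has_sup E.
  by split; [exists (a1 - (u1 ^+ 2 + v1 ^+ 2) / b1), a1, u1, v1, b1 | exists P].
have sP : sup E <= P by apply: ge_sup EP; case: supE.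
(* [C] bounds |u + g b| and |v + h b| for the coefficients g, h chosen below, and [L] bounds the
   second-order coefficient [X / bb]. *)
pose C := W + W / bt * B.
pose L := 2 * C ^+ 2 / bt.
have L0 : 0 <= L by rewrite divr_ge0 ?(ltW bt0)// mulr_ge0 ?sqr_ge0.
(* Small enough that t <= 1 and t L <= e / 2. *)
pose t := e / (e + 2 * L + 1).
have t0 : 0 < t by rewrite divr_gt0//; lra.
have t1 : t <= 1 by rewrite ler_pdivrMr; lra.
have tL : t * L <= e / 2.
  rewrite /t mulrAC ler_pdivrMr; last by lra.
  by have := mulr_ge0 (ltW e0) (ltW e0); lra.
have te0 : 0 < t * (e / 2) by rewrite mulr_gt0// divr_gt0.
have [F0 [a0 [u0 [v0 [b0 [K0 ->]]]]] sF0] := sup_adherent te0 supE.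
have [W0 W0' b0t b0B _] := Kb _ _ _ _ K0.
have b0p : 0 < b0 by lra.
exists (- u0 / b0), (- v0 / b0) => a u v b K2.
set g := - u0 / b0; set h := - v0 / b0; set q := a + _ + _.
have [u2 v2 b2 b2B _] := Kb _ _ _ _ K2.
have Et := Kconv t _ _ _ _ _ _ _ _ (ltW t0) t1 K0 K2.
set bb := (1 - t) * b0 + t * b in Et.
have [_ _ bbt _ _] := Kb _ _ _ _ Et.
have bbp : 0 < bb by lra.
have Fs := sup_upper_bound supE
  (ex_intro _ _ (ex_intro _ _ (ex_intro _ _ (ex_intro _ _ (conj Et erefl))))).
have gE : u0 = - g * b0 by rewrite /g !mulNr opprK divfK// gt_eqF.
have hE : v0 = - h * b0 by rewrite /h !mulNr opprK divfK// gt_eqF.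
have Wp : 0 <= W by apply: le_trans W0.
have Bp : 0 <= B by lra.
have Cp : 0 <= C by rewrite addr_ge0 ?mulr_ge0 ?invr_ge0 ?(ltW bt0).
have bound x x0 y : `|x0| <= W -> `|x| <= W -> y = - x0 / b0 -> (x + y * b) ^+ 2 <= C ^+ 2.
  move=> hx0 hx ->; rewrite -[leLHS]real_normK ?num_real// lerXn2r ?nnegrE//.
  rewrite (le_trans (ler_normD _ _))// lerD// normrM normrM normrN normfV.
  rewrite (gtr0_norm b0p) (@gtr0_norm _ b); last by lra.
  have b0V : b0^-1 <= bt^-1 by rewrite lef_pV2 ?posrE.
  have b0V0 : 0 <= b0^-1 by rewrite invr_ge0 ltW.
  have b0' : 0 <= b by lra.
  exact: (ler_pM (mulr_ge0 (normr_ge0 x0) b0V0) b0' (ler_pM (normr_ge0 x0) b0V0 hx0 b0V) b2B).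
have hu := bound u u0 g W0 u2 erefl; have hv := bound v v0 h W0' v2 erefl.
set X := (u + g * b) ^+ 2 + (v + h * b) ^+ 2.
have XL : X / bb <= L.
  have bbV : bb^-1 <= bt^-1 by rewrite lef_pV2 ?posrE.
  have bbV0 : 0 <= bb^-1 by rewrite invr_ge0 ltW.
  have XC : X <= 2 * C ^+ 2 by rewrite /X; lra.
  exact: (ler_pM (addr_ge0 (sqr_ge0 _) (sqr_ge0 _)) bbV0 XC bbV).
(* Exact expansion in t of the minimal value at the mixture: the first-order gain is [q] minus the
   value at the near-maximiser. *)
have key : (1 - t) * a0 + t * a -
    (((1 - t) * u0 + t * u) ^+ 2 + ((1 - t) * v0 + t * v) ^+ 2) / bb =
  (1 - t) * (a0 - (u0 ^+ 2 + v0 ^+ 2) / b0) + t * q - t ^+ 2 * (X / bb).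
  rewrite /q /X gE hE -/bb.
  have bb0 : bb != 0 by rewrite gt_eqF.
  have b00 : b0 != 0 by rewrite gt_eqF.
  have -> : (1 - t) * (- g * b0) + t * u = - g * bb + t * (u + g * b) by rewrite /bb; ring.
  have -> : (1 - t) * (- h * b0) + t * v = - h * bb + t * (v + h * b) by rewrite /bb; ring.
  transitivity ((1 - t) * a0 + t * a - (g ^+ 2 + h ^+ 2) * bb +
    2 * t * (g * (u + g * b) + h * (v + h * b)) - t ^+ 2 * (X / bb)).
    by rewrite /X; field.
  transitivity ((1 - t) * (a0 - (g ^+ 2 + h ^+ 2) * b0) +
    t * (a + 2 * (g * u + h * v) + (g ^+ 2 + h ^+ 2) * b) - t ^+ 2 * (X / bb)).
    by rewrite /X /bb; ring.
  by congr (_ * _ + _ - _); field.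
move: Fs; rewrite key; set F := a0 - _ in sF0 *; move=> Fs.
have tXL : t ^+ 2 * (X / bb) <= t * (e / 2).
  rewrite expr2 -mulrA ler_pM2l// (le_trans _ tL)// ler_pM2l//.
(* The value at the mixture is at most [sup E], and the near-maximiser is within t e / 2 of it;
   dividing by t leaves q <= P + e. *)
suff : t * q <= t * (P + e) by rewrite ler_pM2l.
have : (1 - t) * (sup E - t * (e / 2)) <= (1 - t) * F by rewrite ler_wpM2l ?subr_ge0// ltW.
have : 0 <= t * (t * (e / 2)) by rewrite mulr_ge0 ?(ltW t0) ?(ltW te0).
have : t * sup E <= t * P by rewrite ler_pM2l.
lra.
Qed.

(** * The pencil T + g S over a positive form *)

Section Pencil.
Variables (R : realType) (V : lmodType R[i]) (phi : V -> V -> R[i]).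
Hypothesis sphi : sesquilinear_form phi.
Hypothesis phi_ge0 : forall x, 0 <= phi x x.
Variables (T S : {linear V -> V}).
Let N x := complex.Re (phi x x).

Definition pencil (g : R[i]) : {linear V -> V} := T \+ g \*: S.

Lemma pencilE g x : pencil g x = T x + g *: S x. Proof. by []. Qed.

Variables cT cS : R.
Hypothesis Tb : forall x, N (T x) <= cT * N x.
Hypothesis Sb : forall x, N (S x) <= cS * N x.

Let a x := N (T x).
Let u x := complex.Re (phi (T x) (S x)).
Let v x := complex.Im (phi (T x) (S x)).
Let b x := N (S x).

Lemma pencil_norm2 g h x : N (pencil (Complex g h) x) =
  a x + 2 * (g * u x + h * v x) + (g ^+ 2 + h ^+ 2) * b x.
Proof.
have := semi_norm2_comb sphi phi_ge0 1 0 g h (T x) (S x).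
rewrite [Complex 1 0 *: _]scale1r {1}/N pencilE => ->.
by rewrite /a /u /v /b -/(N _); ring.
Qed.

Lemma pencil_cross g h x :
  phi (pencil (Complex g h) x) (S x) = Complex (u x + g * b x) (v x + h * b x).
Proof.
rewrite pencilE (sesqDl sphi) (sesqZl sphi) (positive_diag phi_ge0 (S x)) /u /v /b -/(N _).
case: (phi (T x) (S x)) => ? ?; apply/eqP; rewrite eq_complex /=.
by apply/andP; split; apply/eqP; ring.
Qed.

Lemma bounded_null (U : {linear V -> V}) c : (forall x, N (U x) <= c * N x) ->
  forall x, N x = 0 -> N (U x) = 0.
Proof.
move=> Ub x x0; apply/le_anti; rewrite (semi_norm2_ge0 phi_ge0) andbT.
by have := Ub x; rewrite x0 mulr0.
Qed.

Lemma pencil_null g x : N x = 0 -> N (pencil g x) = 0.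
Proof.
move=> x0; case: g => g h; rewrite pencil_norm2 /u /v /a /b.
rewrite (null_orthogonal sphi phi_ge0 _ (bounded_null Tb x0)) /=.
by rewrite (bounded_null Tb x0) (bounded_null Sb x0); ring.
Qed.

(** [HP] bounds the quadratic of a pure state at its minimiser; one g is then found for all unit
    vectors. Mixing in the proportion t of y0 keeps the leading coefficients above t N(S y0), at the
    price of the factor 1 - t. *)
Lemma pencil_minimax (P e t : R) (y0 : V) :
  (forall z g, N z = 1 -> phi (pencil g z) (S z) = 0 -> N (pencil g z) <= P) ->
  N y0 = 1 -> 0 < N (S y0) -> 0 < t -> t <= 1 -> 0 < e ->
  exists g, forall y, N y = 1 -> (1 - t) * N (pencil g y) <= P + e.
Proof.
move=> HP y1 Sy0 t0 t1 e0.
(* The points of K are those dominated, for every g, by a pure state z; by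
   convexity of the numerical range K contains all mixed states. *)
pose W := cT * cS + 1.
pose K a' u' v' b' := [/\ `|u'| <= W, `|v'| <= W, t * N (S y0) <= b', b' <= cS &
  forall g h, exists z, [/\ N z = 1,
    phi (pencil (Complex g h) z) (S z) = Complex (u' + g * b') (v' + h * b') &
    a' + 2 * (g * u' + h * v') + (g ^+ 2 + h ^+ 2) * b' <= N (pencil (Complex g h) z)]].
have mix_le (s p q w : R) : 0 <= s -> s <= 1 -> p <= w -> q <= w -> (1 - s) * p + s * q <= w.
  move=> s0 s1 pw qw.
  have : (1 - s) * p <= (1 - s) * w by rewrite ler_wpM2l ?subr_ge0.
  have : s * q <= s * w by rewrite ler_wpM2l.
  lra.
have mix_norm (s p q : R) : 0 <= s -> s <= 1 -> `|p| <= W -> `|q| <= W ->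
    `|(1 - s) * p + s * q| <= W.
  move=> s0 s1 pw qw; rewrite (le_trans (ler_normD _ _))// !normrM.
  by rewrite (ger0_norm s0) ger0_norm ?subr_ge0// mix_le.
have mix_num s : 0 <= s -> s <= 1 -> forall g x y, N x = 1 -> N y = 1 ->
    exists z, [/\ N z = 1, phi (pencil g z) (S z) =
       (1 - s)%:C * phi (pencil g x) (S x) + s%:C * phi (pencil g y) (S y) &
       (1 - s) * N (pencil g x) + s * N (pencil g y) <= N (pencil g z)].
  move=> s0 s1 g x y x1 yy1; apply: numerical_range_segment => //.
  - exact: pencil_null.
  - exact: bounded_null Sb.
  - by rewrite subr_ge0.
  - by rewrite subrK.
have Tb1 x : N x = 1 -> a x <= cT by move=> x1; have := Tb x; rewrite x1 mulr1.
have Sb1 x : N x = 1 -> b x <= cS by move=> x1; have := Sb x; rewrite x1 mulr1.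
have N0 x : 0 <= N x := semi_norm2_ge0 phi_ge0 x.
(* Since w <= (w + 1)^2, this avoids a square root; hence the [+ 1] in [W]. *)
have sqr_bound (p w : R) : 0 <= w -> p ^+ 2 <= w -> `|p| <= w + 1.
  move=> w0 pw; rewrite -(@ler_pXn2r _ 2) ?nnegrE ?addr_ge0// real_normK ?num_real//.
  by have := sqr_ge0 w; rewrite (_ : (w + 1) ^+ 2 = w ^+ 2 + 2 * w + 1); [lra | ring].
have uv_bound x : N x = 1 -> `|u x| <= W /\ `|v x| <= W.
  move=> x1; have := positive_CauchySchwarz sphi phi_ge0 (T x) (S x).
  rewrite -/(u x) -/(v x) -/(N _) -/(N _) => CS.
  have le_c : N (T x) * N (S x) <= cT * cS by rewrite ler_pM ?N0 ?Tb1 ?Sb1.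
  have c0 : 0 <= cT * cS by rewrite (le_trans _ le_c)// mulr_ge0.
  have := sqr_ge0 (u x); have := sqr_ge0 (v x).
  by split; apply: sqr_bound => //; lra.
have pure y : N y = 1 -> K ((1 - t) * a y + t * a y0) ((1 - t) * u y + t * u y0)
    ((1 - t) * v y + t * v y0) ((1 - t) * b y + t * b y0).
  move=> yy1; have [uy vy] := uv_bound _ yy1; have [uy0 vy0] := uv_bound _ y1.
  split; [exact: mix_norm (ltW t0) _ _ _ | exact: mix_norm (ltW t0) _ _ _ | | |].
  - by rewrite lerDr mulr_ge0 ?subr_ge0 ?N0.
  - by apply: mix_le (ltW t0) _ _ _; rewrite ?Sb1.
  move=> g h; have [z [z1 zE zle]] := mix_num t (ltW t0) t1 (Complex g h) y y0 yy1 y1.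
  exists z; split=> //.
    rewrite zE !pencil_cross; apply/eqP; rewrite eq_complex /=; apply/andP.
    by split; apply/eqP; ring.
  apply: le_trans zle; rewrite !pencil_norm2 le_eqVlt; apply/orP; left; apply/eqP.
  by ring.
have [|||||g [h gh]] := @quadratic_minimax R K P W cS (t * N (S y0)) e.
- move=> s a1 u1 v1 b1 a2 u2 v2 b2 s0 s1 [hu1 hv1 hb1 hc1 H1] [hu2 hv2 hb2 hc2 H2].
  split; [exact: mix_norm | exact: mix_norm | | exact: mix_le |].
    have := mix_le s (- b1) (- b2) (- (t * N (S y0))) s0 s1.
    by rewrite !lerN2 => /(_ hb1 hb2); lra.
  (* For each fixed g, the two dominating pure states are merged into one that dominates the
     mixture. *)
  move=> g h; have [x [x1 xE xle]] := H1 g h; have [y [yy1 yE yle]] := H2 g h.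
  have [z [z1 zE zle]] := mix_num s s0 s1 (Complex g h) x y x1 yy1.
  exists z; split=> //.
    rewrite zE xE yE; apply/eqP; rewrite eq_complex /=; apply/andP.
    by split; apply/eqP; ring.
  apply: le_trans zle.
  have := ler_wpM2l s0 yle; have := ler_wpM2l (_ : 0 <= 1 - s) xle.
  rewrite subr_ge0 => /(_ s1); lra.
- by do 4 eexists; exact: (pure y0 y1).
- by rewrite mulr_gt0.
- exact: e0.
- move=> a1 u1 v1 b1 [hu1 hv1 hb1 hc1 H1]; split=> //.
  have b0 : 0 < b1 by rewrite (lt_le_trans _ hb1)// mulr_gt0.
  (* At the minimising coefficient the cross term vanishes, so [HP] applies to the dominating
     state. *)
  have [z [z1 zE zle]] := H1 (- u1 / b1) (- v1 / b1).
  have zE0 : phi (pencil (Complex (- u1 / b1) (- v1 / b1)) z) (S z) = 0.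
    by rewrite zE !divfK ?gt_eqF// !subrr.
  apply: le_trans (HP _ _ z1 zE0); apply: le_trans zle.
  rewrite le_eqVlt; apply/orP; left; apply/eqP; field; by rewrite gt_eqF.
exists (Complex g h) => y yy1; have := gh _ _ _ _ (pure y yy1).
apply: le_trans; rewrite pencil_norm2.
(* The share of y0 is nonnegative and is dropped. *)
have : 0 <= t * N (pencil (Complex g h) y0) by rewrite mulr_ge0 ?N0// ltW.
rewrite pencil_norm2; lra.
Qed.

End Pencil.

(** * The A-seminorm, the A-operator norm and Phi *)

Section SemiHilbert.
Variables (R : realType) (H : completeNormedModType R[i]).
Variables (ip : {dot H for Num.conj}) (A : {linear H -> H}).
Hypothesis A_pos : positive_operator ip A.

Let phi := ipA ip A.
Let N x := complex.Re (phi x x).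

Lemma sesq_ipA : sesquilinear_form phi.
Proof.
split=> [k x x' y|k x y y']; first by rewrite /phi /ipA !linearP linearPl.
by rewrite /phi /ipA linearPr.
Qed.

Lemma ipA_ge0 x : 0 <= phi x x. Proof. exact: A_pos. Qed.

Lemma sqr_normA x : normA ip A x ^+ 2 = N x.
Proof. by rewrite sqr_sqrtr// (semi_norm2_ge0 ipA_ge0). Qed.

Lemma normA_ge0 x : 0 <= normA ip A x. Proof. exact: sqrtr_ge0. Qed.

Lemma normA_eq1 x : (normA ip A x = 1) <-> (N x = 1).
Proof.
rewrite -sqr_normA; split=> [->|/eqP]; first by rewrite expr1n.
by rewrite sqrp_eq1 ?normA_ge0// => /eqP.
Qed.

Lemma normA_eq0 x : (normA ip A x == 0) = (N x == 0).
Proof. by rewrite -sqr_normA sqrf_eq0. Qed.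

Lemma A_boundedP (U : {linear H -> H}) :
  A_bounded ip A U <-> exists c, forall x, N (U x) <= c * N x.
Proof.
split=> [[c c0 Uc]|[c Uc]].
  exists (c ^+ 2) => x; rewrite -!sqr_normA -exprMn.
  by rewrite lerXn2r ?nnegrE ?mulr_ge0 ?normA_ge0// ltW.
(* The given c may be zero or negative, while [A_bounded] asks for a positive constant. *)
exists (Num.sqrt `|c| + 1); first by rewrite ltr_wpDl ?sqrtr_ge0.
move=> x; rewrite mulrDl mul1r.
apply: (@le_trans _ _ (Num.sqrt `|c| * normA ip A x)); last by rewrite lerDl normA_ge0.
rewrite -sqrtrM// ler_wsqrtr// (le_trans (Uc x))// ler_wpM2r ?ler_norm//.
exact: (semi_norm2_ge0 ipA_ge0).
Qed.

Lemma opnormA_ge0 (U : H -> H) : A_bounded ip A U -> 0 <= opnormA ip A U.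
Proof.
move=> [c c0 Uc]; apply: lb_le_inf; first by exists c.
by move=> d [/ltW].
Qed.

Lemma normA_le_opnormA (U : H -> H) x : A_bounded ip A U -> normA ip A x = 1 ->
  normA ip A (U x) <= opnormA ip A U.
Proof.
move=> [c c0 Uc] x1; apply: lb_le_inf; first by exists c.
by move=> d [_ /(_ x)]; rewrite x1 mulr1.
Qed.

Lemma opnormA_le (U : {linear H -> H}) c : A_bounded ip A U -> 0 < c ->
  (forall x, normA ip A x = 1 -> normA ip A (U x) <= c) -> opnormA ip A U <= c.
Proof.
move=> Ub c0 Uc; apply: ge_inf; first by exists 0 => d [/ltW].
(* A null vector cannot be normalised; A-boundedness sends it to a null vector. Other vectors are
   rescaled to A-norm 1. *)
split=> // x; have [x0|x0] := eqVneq (normA ip A x) 0.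
  by have [d d0 /(_ x)] := Ub; rewrite x0 !mulr0.
have xp : 0 < normA ip A x by rewrite lt_neqAle eq_sym x0 normA_ge0.
set r := normA ip A x in x0 xp *.
have scale (y : H) : normA ip A ((r^-1)%:C *: y) = r^-1 * normA ip A y.
  rewrite /normA -/phi (sesqZl sesq_ipA) (sesqZr sesq_ipA) (positive_diag ipA_ge0 y).
  rewrite [X in _ * (X * _)]conjc_real -!rmorphM /= mulrA sqrtrM ?mulr_ge0 ?invr_ge0 ?ltW//.
  by rewrite -expr2 sqrtr_sqr ger0_norm// invr_ge0 ltW.
have := Uc ((r^-1)%:C *: x); rewrite linearZ /= !scale mulVf// => /(_ erefl).
by rewrite mulrC ler_pdivrMr.
Qed.

Section Distance.
Variables T S : {linear H -> H}.
Hypotheses (Tb : A_bounded ip A T) (Sb : A_bounded ip A S).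

Lemma A_bounded_pencil g : A_bounded ip A (pencil T S g).
Proof.
have /A_boundedP[c Tc] := Tb; have /A_boundedP[d Sd] := Sb.
apply/A_boundedP; case: g => g h; exists (2 * c + 2 * (g ^+ 2 + h ^+ 2) * d) => x.
(* Parallelogram law: N((T + g S) x) + N((T - g S) x) = 2 N(T x) + 2 |g|^2 N(S x). *)
have := semi_norm2_ge0 ipA_ge0 (pencil T S (Complex (- g) (- h)) x).
rewrite /N !(pencil_norm2 sesq_ipA ipA_ge0) -/(N _) -/(N _).
have gh : 0 <= g ^+ 2 + h ^+ 2 by rewrite addr_ge0 ?sqr_ge0.
by have := Tc x; have := ler_wpM2l gh (Sd x); lra.
Qed.

(** Completing the square: the difference is |<T x, S x>_A + g N(S x)|^2 / N(S x). If N(S x) = 0,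
    the cross term vanishes too. *)
Lemma PhiA_le_pencil g x : PhiA ip A T S x <= N (pencil T S g x).
Proof.
case: g => g h; rewrite /N (pencil_norm2 sesq_ipA ipA_ge0) -!/(N _) /PhiA normA_eq0 -/phi.
rewrite !sqr_normA; case: eqVneq => [b0|b0] /=.
  have c0 : phi (T x) (S x) = 0.
    rewrite (positive_hermitian sesq_ipA ipA_ge0 (S x)).
    by rewrite (null_orthogonal sesq_ipA ipA_ge0 _ b0) conjc0.
  by rewrite c0 b0 /= !mulr0 !addr0 mulr0 addr0.
case: (phi (T x) (S x)) => u v /=; rewrite sqr_sqrtr ?addr_ge0 ?sqr_ge0//.
have bp : 0 < N (S x) by rewrite lt_neqAle eq_sym b0 (semi_norm2_ge0 ipA_ge0).
rewrite -subr_ge0; set b := N (S x) in b0 bp *.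
rewrite (_ : _ - _ = ((u + g * b) ^+ 2 + (v + h * b) ^+ 2) / b); last by field.
by rewrite divr_ge0 ?addr_ge0 ?sqr_ge0 ?ltW.
Qed.

(** Orthogonality to S x says that g minimises the quadratic, whose minimum is Phi. *)
Lemma pencil_le_PhiA g x : phi (pencil T S g x) (S x) = 0 ->
  N (pencil T S g x) <= PhiA ip A T S x.
Proof.
case: g => g h; rewrite (pencil_cross sesq_ipA ipA_ge0) /N.
rewrite (pencil_norm2 sesq_ipA ipA_ge0) -!/(N _) /PhiA normA_eq0 -/phi !sqr_normA.
case: (phi (T x) (S x)) => u v /= [u0 v0]; rewrite sqr_sqrtr ?addr_ge0 ?sqr_ge0//.
set b := N (S x) in u0 v0 *.
have -> : u = - (g * b) by lra.
have -> : v = - (h * b) by lra.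
case: eqVneq => [->|b0] /=; first by rewrite !mulr0 oppr0 !mulr0 !addr0 mulr0 addr0.
by rewrite le_eqVlt; apply/orP; left; apply/eqP; field.
Qed.

Lemma PhiA_ge0 x : 0 <= PhiA ip A T S x.
Proof.
rewrite /PhiA normA_eq0 !sqr_normA -/phi; have N0 y : 0 <= N y := semi_norm2_ge0 ipA_ge0 y.
case: eqVneq => [_|b0] /=; first exact: N0.
have := positive_CauchySchwarz sesq_ipA ipA_ge0 (T x) (S x).
case: (phi (T x) (S x)) => u v /= CS; rewrite sqr_sqrtr; last by rewrite addr_ge0 ?sqr_ge0.
by rewrite subr_ge0 ler_pdivrMr// lt_neqAle eq_sym b0 N0.
Qed.

End Distance.
End SemiHilbert.

(** * The distance formula *)

Unset Implicit Arguments.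

Theorem theorem3p4 (R : realType) (H : completeNormedModType R[i])
    (ip : {dot H for Num.conj}) (ip_norm : inner_product_norm ip)
    (A T S : {linear H -> H})
    (A_bnd : bounded_operator A) (A_pos : positive_operator ip A)
    (T_bnd : bounded_operator T) (T_Abnd : A_bounded ip A T)
    (S_bnd : bounded_operator S) (S_Abnd : A_bounded ip A S) :
  (inf [set opnormA ip A (T \+ g \*: S) | g in [set: R[i]]]) ^+ 2 =
  sup [set PhiA ip A T S x | x in [set x : H | normA ip A x = 1]].
Proof.
set mu := inf _; set E := [set _ | _ in _]; set P := sup E.
have [[cT Tc] [cS Sc]] := ((A_boundedP A_pos T).1 T_Abnd, (A_boundedP A_pos S).1 S_Abnd).
have Pb g := A_bounded_pencil A_pos T_Abnd S_Abnd g.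
have lb0 : lbound [set opnormA ip A (T \+ g \*: S) | g in [set: R[i]]] 0.
  by move=> _ [g _ <-]; apply: (opnormA_ge0 (Pb g)).
have mu0 : 0 <= mu by apply: lb_le_inf => //; exists (opnormA ip A (T \+ 0 \*: S)), 0.
have mu_le g : mu <= opnormA ip A (pencil T S g) by apply: ge_inf; [exists 0 | exists g].
have Phi_mu x : normA ip A x = 1 -> PhiA ip A T S x <= mu ^+ 2.
  move=> x1; rewrite -[leLHS]sqr_sqrtr ?(PhiA_ge0 A_pos)//.
  rewrite lerXn2r ?nnegrE ?sqrtr_ge0//; apply: lb_le_inf.
    by exists (opnormA ip A (T \+ 0 \*: S)), 0.
  move=> _ [g _ <-]; apply: le_trans (normA_le_opnormA (Pb g) x1).
  rewrite -[leRHS]ger0_norm ?normA_ge0// -sqrtr_sqr ler_wsqrtr// (sqr_normA A_pos).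
  exact: PhiA_le_pencil.
have Phi_P x : normA ip A x = 1 -> PhiA ip A T S x <= P.
  by move=> x1; apply: ub_le_sup; [exists (mu ^+ 2) => _ [y /Phi_mu ? <-] | exists x].
(* Without vectors of A-norm 1, the supremum is 0 by convention, and every positive constant bounds
   the A-operator norms, so mu = 0. *)
have [E0|] := eqVneq E set0.
  have no x : normA ip A x = 1 -> False.
    by move=> x1; have : E (PhiA ip A T S x) by [exists x]; rewrite E0.
  rewrite /P E0 sup0; apply/eqP; rewrite sqrf_eq0 eq_le mu0 andbT.
  apply/ler_addgt0Pr => e e0; rewrite add0r (le_trans (mu_le 0))//.
  by apply: (opnormA_le A_pos (Pb 0)) => // x /no.
move=> /set0P[_ [x0 x01 _]].
have P0 : 0 <= P := le_trans (PhiA_ge0 A_pos T S x0) (Phi_P _ x01).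
apply/le_anti/andP; split; last first.
  by apply: ge_sup; [exists (PhiA ip A T S x0), x0 | move=> _ [x /Phi_mu ? <-]].
apply/ler_addgt0Pr => e e0.
suff [g gle] : exists g, forall y, normA ip A y = 1 ->
    normA ip A (pencil T S g y) ^+ 2 <= P + e.
  have Pe : 0 < P + e by lra.
  rewrite -[leRHS]sqr_sqrtr ?(ltW Pe)// lerXn2r ?nnegrE ?sqrtr_ge0//.
  rewrite (le_trans (mu_le g))//; apply: (opnormA_le A_pos (Pb g)); rewrite ?sqrtr_gt0//.
  move=> y y1; rewrite -[leLHS]ger0_norm ?normA_ge0// -sqrtr_sqr ler_wsqrtr//.
  exact: gle.
have [[y0 [y01 Sy0]]|noS] :=
  pselect (exists y0, normA ip A y0 = 1 /\ normA ip A (S y0) != 0).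
  have Pe : 0 < P + e by lra.
  (* Chosen so that (1 - t) (P + e) = P + e / 2. *)
  pose t := e / 2 / (P + e).
  have t0 : 0 < t by rewrite !divr_gt0.
  have tPe : t * (P + e) = e / 2 by rewrite divfK// gt_eqF.
  have t1 : t < 1 by rewrite /t ltr_pdivrMr//; lra.
  have [||||||g gle] := @pencil_minimax _ _ _ (sesq_ipA ip A) (ipA_ge0 A_pos) T S
      cT cS Tc Sc P (e / 2) t y0.
  - move=> z g /(normA_eq1 A_pos) z1 /(pencil_le_PhiA A_pos) h.
    exact: le_trans h (Phi_P z z1).
  - exact/(normA_eq1 A_pos).
  - by rewrite -(sqr_normA A_pos) exprn_even_gt0.
  - exact: t0.
  - exact: ltW.
  - by rewrite divr_gt0.
  exists g => y /(normA_eq1 A_pos) y1; rewrite (sqr_normA A_pos).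
  have := gle _ y1; set n := complex.Re _ => h.
  have t1' : 0 < 1 - t by rewrite subr_gt0.
  by rewrite -(ler_pM2l t1') (le_trans h)//; lra.
(* Here S is null on all A-unit vectors, so Phi is the squared A-norm of T y and g = 0 works. *)
exists 0 => y y1.
have Sy : normA ip A (S y) = 0.
  by apply/eqP; apply: contra_notT noS => Sy; exists y.
have := Phi_P y y1; rewrite /PhiA Sy eqxx /= => h.
by rewrite scale0r addr0 (le_trans h)// lerDl ltW.
Qed.
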